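(* Consider the scheduling game on uniform machines under the RANDOM policy: there are $n$ jobs with lengths $p_1,\dots,p_n>0$ and $m$ machines with speeds $s_1,\dots,s_m>0$, and the processing time of job $i$ on machine $j$ is $p_{i,j}=p_i/s_j$. Then this game is a potential game: starting from any strategy profile, every sequence of better-response moves is finite.
   Context: Scheduling game: each of the $n$ jobs is a player choosing one machine; a strategy profile is a map $\sigma:\{1,\dots,n\}\to\{1,\dots,m\}$. Under the RANDOM policy (jobs on a machine are processed in uniformly random order, without preemption), the cost of job $i$ with $\sigma(i)=j$ is its expected completion time $c_i(\sigma)=p_{i,j}+\frac12\sum_{i'\neq i:\ \sigma(i')=j}p_{i',j}$. A better-response move is a change of machine by a single job, all other jobs keeping their machines, that strictly decreases that job's cost. A game is a potential game if the better-response dynamic always converges, i.e. from any profile every sequence of better-response moves is finite. *)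

(* Defs.v *)
From HB Require Import structures.
From mathcomp Require Import all_boot all_order all_algebra.

Set Implicit Arguments.
Unset Strict Implicit.
Unset Printing Implicit Defensive.

Import Order.TTheory GRing.Theory Num.Theory.
Local Open Scope ring_scope.

Section SchedulingGame.
Variables (R : realFieldType) (n m : nat).

Definition profile := {ffun 'I_n -> 'I_m}.

(* [p i j] is the processing time of job [i] on machine [j]. The expected
   completion time of job [i] under a uniformly random order: each other job on
   the same machine precedes [i] with probability 1/2. *)
Definition random_cost (p : 'I_n -> 'I_m -> R) (sigma : profile) (i : 'I_n) : R :=
  p i (sigma i)
  + 2^-1 * \sum_(i' < n | (i' != i) && (sigma i' == sigma i)) p i' (sigma i).

Definition better_response_move (cost : profile -> 'I_n -> R)
    (sigma sigma' : profile) : Prop :=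
  exists i : 'I_n,
    [/\ sigma' i <> sigma i,
        forall i' : 'I_n, i' <> i -> sigma' i' = sigma i'
      & cost sigma' i < cost sigma i].

Definition potential_game (cost : profile -> 'I_n -> R) : Prop :=
  forall sigma : profile,
    ~ exists u : nat -> profile,
        u 0%N = sigma /\ forall k : nat, better_response_move cost (u k) (u k.+1).

Definition uniform_time (len : 'I_n -> R) (speed : 'I_m -> R)
    (i : 'I_n) (j : 'I_m) : R := len i / speed j.

End SchedulingGame.

(* Main.v *)
Require Import Defs.
From HB Require Import structures.
From mathcomp Require Import all_boot all_order all_algebra.
From mathcomp Require Import ring.

Set Implicit Arguments.
Unset Strict Implicit.
Unset Printing Implicit Defensive.

Import Order.TTheory GRing.Theory Num.Theory.
Local Open Scope ring_scope.

(** Writing [L_j] for the total length of the jobs on machine [j], the function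
    [\sum_j (L_j ^+ 2 + 3 * \sum_(i on j) len i ^+ 2) / speed j] is a weighted
    potential: a move of job [i] changes it by [4 * len i] times the change of
    the cost of [i]. Hence it strictly decreases along better-response moves,
    and there are finitely many profiles. *)

(** Pigeonhole: strict descent makes the terms of [u] pairwise distinct, but the first [#|T|.+1] of
    them cannot be. *)
Lemma no_infinite_descent (R : realFieldType) (T : finType) (f : T -> R)
    (u : nat -> T) :
  ~ forall k, f (u k.+1) < f (u k).
Proof.
move=> dec.
have mono : {homo (f \o u) : a b / (a < b)%N >-> a > b}.
  by apply: homo_ltn => // y x z xy yz; apply: lt_trans yz xy.
have inj : injective (fun k : 'I_#|T|.+1 => u k).
  move=> a b eq_uab; apply: val_inj => /=.
  by case: (ltngtP a b) => // /mono /=; rewrite eq_uab ltxx.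
by have := leq_card _ inj; rewrite card_ord ltnn.
Qed.

Section UniformMachines.
Variables (R : realFieldType) (n m : nat).
Variables (len : 'I_n -> R) (speed : 'I_m -> R).
Implicit Types (sigma : profile n m) (i : 'I_n) (j : 'I_m).

Definition potential sigma : R :=
  \sum_j ((\sum_(i | sigma i == j) len i) ^+ 2
          + 3 * \sum_(i | sigma i == j) len i ^+ 2) / speed j.

(** The share of [potential] that a move of [i] leaves unchanged. *)
Definition potential_without i sigma : R :=
  \sum_j ((\sum_(k | (k != i) && (sigma k == j)) len k) ^+ 2
          + 3 * \sum_(k | (k != i) && (sigma k == j)) len k ^+ 2) / speed j.

Lemma big_machine_split sigma i j (F : 'I_n -> R) :
  \sum_(k | sigma k == j) F k =
  \sum_(k | (k != i) && (sigma k == j)) F k + (sigma i == j)%:R * F i.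
Proof.
rewrite addrC big_mkcond (bigD1 i) //= [in RHS]big_mkcondr /=.
by congr (_ + _); case: (sigma i == j); rewrite ?mul1r ?mul0r.
Qed.

(** Adding a job of length [l] to a load [x] raises the square by [2 * x * l + l ^+ 2]. The weight 3
    brings the last term to [4 * l ^+ 2], and the total is [4 * l * (l + x / 2)], in the proportion
    of the RANDOM cost. *)
Lemma potentialE sigma i :
  potential sigma = potential_without i sigma
    + 4 * len i * random_cost (uniform_time len speed) sigma i.
Proof.
pose X j := \sum_(k | (k != i) && (sigma k == j)) len k.
(* Spreading the cost over all machines, with zero terms away from [sigma i], lets the identity be
   checked machine by machine. *)
have -> : 4 * len i * random_cost (uniform_time len speed) sigma i =
    \sum_j (sigma i == j)%:R * ((2 * X j + 4 * len i) * len i / speed j).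
  rewrite (bigD1 (sigma i)) //= eqxx mul1r big1 ?addr0; last first.
    by move=> j /negPf; rewrite eq_sym => ->; rewrite mul0r.
  rewrite /random_cost /uniform_time -mulr_suml -/(X _).
  (* With the inverse speed abstracted, [2^-1] is the only inverse left for [field]. *)
  by move: (X _) (speed _)^-1 => x v; field.
rewrite -big_split; apply: eq_bigr => j _ /=.
rewrite !(big_machine_split sigma i) -/(X j).
by case: (sigma i == j); rewrite ?mul1r ?mul0r; ring.
Qed.

Lemma eq_potential_without i sigma sigma' :
    (forall k, k <> i -> sigma' k = sigma k) ->
  potential_without i sigma' = potential_without i sigma.
Proof.
move=> eq_sigma; apply: eq_bigr => j _.
have same_jobs k : (k != i) && (sigma' k == j) = (k != i) && (sigma k == j).
  by case: (k =P i) => //= /eq_sigma ->.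
by rewrite !(eq_bigl _ _ same_jobs).
Qed.

Lemma potential_decreases sigma sigma' :
    (forall i, 0 < len i) ->
    better_response_move (random_cost (uniform_time len speed)) sigma sigma' ->
  potential sigma' < potential sigma.
Proof.
move=> len_gt0 [i [_ eq_sigma lt_cost]].
rewrite !(potentialE _ i) (eq_potential_without eq_sigma) ltrD2l.
by rewrite ltr_pM2l // mulr_gt0.
Qed.

End UniformMachines.

Theorem theorem1 (R : realFieldType) (n m : nat)
    (len : 'I_n -> R) (speed : 'I_m -> R)
    (len_gt0 : forall i, 0 < len i) (speed_gt0 : forall j, 0 < speed j) :
  potential_game (random_cost (uniform_time len speed)).
Proof.
move=> sigma [u [_ moves]].
apply: (@no_infinite_descent R _ (potential len speed) u) => k.
exact: potential_decreases.
Qed.
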